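(* Let $V=\bigoplus_{r,s\in\mathbb{Z}}V_{r,s}$ be an irreducible $\mathcal{L}$-module such that $\dim V_{r,s}<\infty$ for all $r,s\in\mathbb{Z}$ and $$L_{a,b}V_{r,s}\subseteq V_{r+a,s+b+2}+V_{r+a,s+b+1}+V_{r+a,s+b}\qquad\text{for all }a,b,r,s\in\mathbb{Z}.$$ If $V$ is not uniformly bounded, then $V$ is a $GHW$ module.
   Context: $\mathcal{L}$ (the non-graded Virasoro-like algebra) is the complex Lie algebra with basis $\{L_{\alpha,\beta},\,c\mid \alpha,\beta\in\mathbb{Z}\}$ and bracket $[L_{\alpha,\beta},c]=0$, $$[L_{\alpha_1,\beta_1},L_{\alpha_2,\beta_2}]=(\alpha_2-\alpha_1)L_{\alpha_1+\alpha_2,\beta_1+\beta_2+1}+(\beta_2-\beta_1)L_{\alpha_1+\alpha_2,\beta_1+\beta_2}+\tfrac{1}{12}\delta_{\alpha_1+\alpha_2,0}\big[\delta_{\beta_1+\beta_2,-3}\alpha_1^3+3\delta_{\beta_1+\beta_2,-2}(\beta_1+1)\alpha_1^2+3\delta_{\beta_1+\beta_2,-1}\beta_1(\beta_1+1)\alpha_1+\delta_{\beta_1+\beta_2,0}\beta_1(\beta_1^2-1)\big]c.$$ For $\alpha=(p,q)\in\mathbb{Z}\times\mathbb{Z}$ write $L_\alpha=L_{p,q}$; put $e_1=(1,0)$, $e_2=(0,1)$. A pair $\{\alpha_1,\alpha_2\}\subset\mathbb{Z}\times\mathbb{Z}$ is a $\mathbb{Z}$-basis of $\mathbb{Z}\times\mathbb{Z}$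 if every $\alpha\in\mathbb{Z}\times\mathbb{Z}$ is of the form $k_1\alpha_1+k_2\alpha_2$ with $k_1,k_2\in\mathbb{Z}$. An $\mathcal{L}$-module $V=\bigoplus_{r,s}V_{r,s}$ is uniformly bounded if there is a positive integer $N$ with $\dim V_{r,s}\le N$ for all $r,s\in\mathbb{Z}$. It is called a $GHW$ module if $V$ is generated by a vector $v$ and there is a $\mathbb{Z}$-basis $\{\alpha_1,\alpha_2\}$ of $\mathbb{Z}\times\mathbb{Z}$ such that $L_\alpha v=0$ for all $\alpha=k_1\alpha_1+k_2\alpha_2+k(1-\delta_{k_1k_2,0})e_2$, where $k_1,k_2$ are non-negative integers, not both zero, and $k$ is an integer with $0\le k\le k_1+k_2$. *)

(* Defs.v *)
From HB Require Import structures.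
From mathcomp Require Import all_boot all_order all_algebra.
From mathcomp Require Import finmap monalg complex reals ring zify.

Set Implicit Arguments.
Unset Strict Implicit.
Unset Printing Implicit Defensive.
Import Order.TTheory GRing.Theory Num.Theory.
Local Open Scope ring_scope.

HB.mixin Record Lmodule_isLieAlgebra (K : fieldType) g of GRing.Lmodule K g := {
  lie : g -> g -> g;
  lieDl : forall y, {morph lie^~ y : x1 x2 / x1 + x2};
  lieZl : forall (a : K) x y, lie (a *: x) y = a *: lie x y;
  lieDr : forall x, {morph lie x : y1 y2 / y1 + y2};
  lieZr : forall (a : K) x y, lie x (a *: y) = a *: lie x y;
  liexx : forall x, lie x x = 0;
  lie_jacobi : forall x y z,
    lie x (lie y z) + lie y (lie z x) + lie z (lie x y) = 0
}.

#[short(type="lieAlgType")]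
HB.structure Definition LieAlgebra (K : fieldType) :=
  { g of GRing.Lmodule K g & Lmodule_isLieAlgebra K g }.

HB.mixin Record Lmodule_isLieModule (K : fieldType) (g : lieAlgType K) V
    of GRing.Lmodule K V := {
  act : g -> V -> V;
  actDl : forall v, {morph act^~ v : x y / x + y};
  actZl : forall (a : K) x v, act (a *: x) v = a *: act x v;
  actDr : forall x, {morph act x : v w / v + w};
  actZr : forall (a : K) x v, act x (a *: v) = a *: act x v;
  act_lie : forall x y v, act (lie x y) v = act x (act y v) - act y (act x v)
}.

#[short(type="lieModType")]
HB.structure Definition LieModule (K : fieldType) (g : lieAlgType K) :=
  { V of GRing.Lmodule K V & Lmodule_isLieModule K g V }.

Section Subspaces.
Variables (K : fieldType) (V : lmodType K).

Definition is_subspace (U : V -> Prop) : Prop :=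
  U 0 /\ forall (a : K) u v, U u -> U v -> U (a *: u + v).

Definition has_dim (U : V -> Prop) (d : nat) : Prop :=
  exists e : 'I_d -> V,
    [/\ forall i, U (e i),
        forall c : 'I_d -> K, \sum_i c i *: e i = 0 -> forall i, c i = 0
      & forall u, U u -> exists c : 'I_d -> K, u = \sum_i c i *: e i].

Definition finite_dim (U : V -> Prop) : Prop := exists d, has_dim U d.

Definition is_direct_sum (I : eqType) (U : I -> V -> Prop) : Prop :=
  (forall v, exists (r : seq I) (u : I -> V),
      (forall i, U i (u i)) /\ v = \sum_(i <- r) u i)
  /\ (forall (r : seq I) (u : I -> V),
      uniq r -> (forall i, U i (u i)) -> \sum_(i <- r) u i = 0 ->
      forall i, i \in r -> u i = 0).

Definition uniformly_bounded (U : int -> int -> V -> Prop) : Prop :=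
  exists N : nat, (0 < N)%N /\
    forall r s, exists d, (d <= N)%N /\ has_dim (U r s) d.

End Subspaces.

Section LieModules.
Variables (K : fieldType) (g : lieAlgType K) (V : lieModType g).

Definition is_submodule (U : V -> Prop) : Prop :=
  is_subspace U /\ forall (x : g) u, U u -> U (act x u).

Definition irreducible_module : Prop :=
  (exists v : V, v <> 0) /\
  forall U, is_submodule U -> (forall u, U u -> u = 0) \/ (forall u, U u).

Definition generates (v : V) : Prop :=
  forall U, is_submodule U -> U v -> forall w, U w.

End LieModules.

(* 12 times the coefficient of c in the bracket of two basis elements. *)
Definition cocycle (al1 al2 : int * int) : int :=
  let: (a1, b1) := al1 in let: (a2, b2) := al2 in
  (a1 + a2 == 0)%:R *
    ((b1 + b2 == -3)%:R * a1 ^+ 3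
     + 3 * (b1 + b2 == -2)%:R * (b1 + 1) * a1 ^+ 2
     + 3 * (b1 + b2 == -1)%:R * b1 * (b1 + 1) * a1
     + (b1 + b2 == 0)%:R * b1 * (b1 ^+ 2 - 1)).

Arguments cocycle : simpl never.

Lemma cocycleC al1 al2 : cocycle al1 al2 = - cocycle al2 al1.
Proof.
case: al1 al2 => [a1 b1] [a2 b2]; rewrite /cocycle [a2 + _]addrC [b2 + _]addrC.
have [/eqP|] := eqVneq (a1 + a2) 0; last by rewrite !mul0r oppr0.
rewrite addr_eq0 => /eqP ->; set s := b1 + b2.
have -> : b2 = s - b1 by rewrite /s addrC addKr.
have [->|_] := eqVneq s (-3); first by rewrite /=; ring.
have [->|_] := eqVneq s (-2); first by rewrite /=; ring.
have [->|_] := eqVneq s (-1); first by rewrite /=; ring.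
by have [->|_] := eqVneq s 0; rewrite /=; ring.
Qed.

Lemma cocycle_jacobi a1 b1 a2 b2 a3 b3 :
  let T a1 b1 a2 b2 a3 b3 : int :=
    (a3 - a2) * cocycle (a1, b1) (a2 + a3, b2 + b3 + 1)
    + (b3 - b2) * cocycle (a1, b1) (a2 + a3, b2 + b3) in
  T a1 b1 a2 b2 a3 b3 + T a2 b2 a3 b3 a1 b1 + T a3 b3 a1 b1 a2 b2 = 0.
Proof.
move=> T; rewrite /T /cocycle {T}.
have -> : a2 + (a3 + a1) = a1 + (a2 + a3) by ring.
have -> : a3 + (a1 + a2) = a1 + (a2 + a3) by ring.
have -> : b2 + (b3 + b1 + 1) = b1 + (b2 + b3 + 1) by ring.
have -> : b3 + (b1 + b2 + 1) = b1 + (b2 + b3 + 1) by ring.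
have -> : b2 + (b3 + b1) = b1 + (b2 + b3) by ring.
have -> : b3 + (b1 + b2) = b1 + (b2 + b3) by ring.
have -> : b1 + (b2 + b3 + 1) = b1 + (b2 + b3) + 1 by ring.
have [Ea|_] := eqVneq (a1 + (a2 + a3)) 0; last by rewrite !mul0r !mulr0 !addr0.
have -> : a3 = - a1 - a2 by rewrite -[LHS]subr0 -Ea; ring.
set s := b1 + (b2 + b3).
have -> : b3 = s - b1 - b2 by rewrite /s; ring.
have [->|n4] := eqVneq s (-4); first by rewrite /=; ring.
have [->|n3] := eqVneq s (-3); first by rewrite /=; ring.
have [->|n2] := eqVneq s (-2); first by rewrite /=; ring.
have [->|n1] := eqVneq s (-1); first by rewrite /=; ring.
have [->|n0] := eqVneq s 0; first by rewrite /=; ring.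
have -> : s + 1 == -3 = false by lia.
have -> : s + 1 == -2 = false by lia.
have -> : s + 1 == -1 = false by lia.
have -> : s + 1 == 0 = false by lia.
by rewrite /=; ring.
Qed.

(* Over an abstract space, so that unification never unfolds [{malg _}]. *)
Section BracketOfBasis.
Variables (K : numFieldType) (g : lmodType K).
Variables (e : option (int * int) -> g) (br : g -> g -> g).
Variables
  (ind : forall P : g -> Prop,
     P 0 -> (forall x y, P x -> P y -> P (x + y)) ->
     (forall (a : K) x, P x -> P (a *: x)) -> (forall i, P (e i)) ->
     forall x, P x)
  (brDl : forall y, {morph br^~ y : x1 x2 / x1 + x2})
  (brZl : forall (a : K) x y, br (a *: x) y = a *: br x y)
  (brDr : forall x, {morph br x : y1 y2 / y1 + y2})
  (brZr : forall (a : K) x y, br x (a *: y) = a *: br x y)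
  (brNe : forall i, br (e None) (e i) = 0)
  (breN : forall i, br (e i) (e None) = 0)
  (bree : forall a1 b1 a2 b2, br (e (Some (a1, b1))) (e (Some (a2, b2))) =
     (a2 - a1)%:~R *: e (Some (a1 + a2, b1 + b2 + 1))
     + (b2 - b1)%:~R *: e (Some (a1 + a2, b1 + b2))
     + (12%:R^-1 * (cocycle (a1, b1) (a2, b2))%:~R) *: e None).

Let br0l y : br 0 y = 0.
Proof. by have := brZl 0 0 y; rewrite !scale0r. Qed.

Let br0r x : br x 0 = 0.
Proof. by have := brZr 0 x 0; rewrite !scale0r. Qed.

Let breC i j : br (e i) (e j) = - br (e j) (e i).
Proof.
case: i j => [[a1 b1]|] [[a2 b2]|]; rewrite ?brNe ?breN ?oppr0 //.
rewrite !bree cocycleC (addrC a2 a1) (addrC b2 b1) mulrNz mulrN.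
by rewrite !opprD -!scaleNr -!mulrNz !opprB.
Qed.

Lemma brC x y : br x y = - br y x.
Proof.
elim/ind: x => [|x1 x2 IH1 IH2|a x IH|i].
- by rewrite br0l br0r oppr0.
- by rewrite brDl brDr IH1 IH2 opprD.
- by rewrite brZl brZr IH scalerN.
elim/ind: y => [|y1 y2 IH1 IH2|a y IH|j].
- by rewrite br0l br0r oppr0.
- by rewrite brDl brDr IH1 IH2 opprD.
- by rewrite brZl brZr IH scalerN.
exact: breC.
Qed.

Lemma brxx x : br x x = 0.
Proof.
have /eqP := brC x x; rewrite -addr_eq0 -mulr2n -scaler_nat scaler_eq0.
by rewrite pnatr_eq0 /= => /eqP.
Qed.

Let brN x : br x (e None) = 0.
Proof.
elim/ind: x => [|x1 x2 IH1 IH2|a x IH|i]; rewrite ?br0l ?brDl ?brZl //.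
- by rewrite IH1 IH2 addr0.
- by rewrite IH scaler0.
Qed.

Let comb4 (c1 c2 c3 c4 d1 d2 d3 d4 f1 f2 f3 f4 : K) (u v w z : g) :
  c1 + d1 + f1 = 0 -> c2 + d2 + f2 = 0 -> c3 + d3 + f3 = 0 ->
  c4 + d4 + f4 = 0 ->
  (c1 *: u + c2 *: v + c3 *: w + c4 *: z)
  + (d1 *: u + d2 *: v + d3 *: w + d4 *: z)
  + (f1 *: u + f2 *: v + f3 *: w + f4 *: z) = 0.
Proof.
move=> E1 E2 E3 E4.
have add4 (p q r s p' q' r' s' : g) :
    p + q + r + s + (p' + q' + r' + s')
    = (p + p') + (q + q') + (r + r') + (s + s').
  rewrite addrACA; congr (_ + _); rewrite addrACA; congr (_ + _).
  by rewrite addrACA.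
rewrite (add4 (c1 *: u)) (add4 (_ + _)) -!scalerDl E1 E2 E3 E4.
by rewrite !scale0r !addr0.
Qed.

Let comb2 (a b p q r k l : K) (u v w z : g) :
  a *: (p *: u + q *: v + k *: z) + b *: (p *: v + r *: w + l *: z)
  = (a * p) *: u + (a * q + b * p) *: v + (b * r) *: w + (a * k + b * l) *: z.
Proof.
rewrite !scalerDr !scalerA !scalerDl -!addrA.
by congr (_ + _); congr (_ + _); rewrite addrCA; congr (_ + _); rewrite addrCA.
Qed.

Let breee (a b x1 y1 x2 y2 x3 y3 : int) :
  x1 + (x2 + x3) = a -> y1 + (y2 + y3) = b ->
  br (e (Some (x1, y1))) (br (e (Some (x2, y2))) (e (Some (x3, y3)))) =
    ((x3 - x2) * (x2 + x3 - x1))%:~R *: e (Some (a, b + 2))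
    + ((x3 - x2) * (y2 + y3 + 1 - y1)
       + (y3 - y2) * (x2 + x3 - x1))%:~R *: e (Some (a, b + 1))
    + ((y3 - y2) * (y2 + y3 - y1))%:~R *: e (Some (a, b))
    + (12%:R^-1 * ((x3 - x2) * cocycle (x1, y1) (x2 + x3, y2 + y3 + 1)
        + (y3 - y2) * cocycle (x1, y1) (x2 + x3, y2 + y3))%:~R) *: e None.
Proof.
move=> Ea Eb; rewrite bree !brDr !brZr brN scaler0 addr0 !bree Ea Eb.
have -> : y1 + (y2 + y3 + 1) = b + 1 by rewrite -Eb; ring.
have -> : b + 1 + 1 = b + 2 by ring.
move: (cocycle _ _) (cocycle _ _) => m1 m2.
have intrDM (p q r s : int) :
    (p * q + r * s)%:~R = p%:~R * q%:~R + r%:~R * s%:~R :> K.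
  by rewrite intrD !intrM.
rewrite comb2 !intrDM !intrM mulrDr.
by rewrite (mulrCA _ 12%:R^-1 m2%:~R) (mulrCA _ 12%:R^-1 m1%:~R).
Qed.

Lemma br_jacobi x y z : br x (br y z) + br y (br z x) + br z (br x y) = 0.
Proof.
have addACA3 (p q r p' q' r' : g) : p + q + r = 0 -> p' + q' + r' = 0 ->
    p + p' + (q + q') + (r + r') = 0.
  by move=> E E'; rewrite (addrACA p p') (addrACA (p + q)) E E' addr0.
elim/ind: x => [|x1 x2 IH1 IH2|a x IH|i].
- by rewrite !(br0l, br0r, addr0).
- by rewrite !(brDl, brDr) addACA3.
- by rewrite !(brZl, brZr) -!scalerDr IH scaler0.
elim/ind: y => [|y1 y2 IH1 IH2|a y IH|j].
- by rewrite !(br0l, br0r, addr0).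
- by rewrite !(brDl, brDr) addACA3.
- by rewrite !(brZl, brZr) -!scalerDr IH scaler0.
elim/ind: z => [|z1 z2 IH1 IH2|a z IH|k].
- by rewrite !(br0l, br0r, addr0).
- by rewrite !(brDl, brDr) addACA3.
- by rewrite !(brZl, brZr) -!scalerDr IH scaler0.
have cE t : br (e None) t = 0 by rewrite brC brN oppr0.
case: i => [[a1 b1]|]; last by rewrite !(cE, brN, br0r, addr0).
case: j => [[a2 b2]|]; last by rewrite !(cE, brN, br0r, addr0).
case: k => [[a3 b3]|]; last by rewrite !(cE, brN, br0r, addr0).
have E (x1 x2 x3 : int) : x2 + (x3 + x1) = x1 + (x2 + x3) by ring.
have E' (x1 x2 x3 : int) : x3 + (x1 + x2) = x1 + (x2 + x3) by ring.
rewrite (breee erefl erefl) (breee (E a1 a2 a3) (E b1 b2 b3)).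
rewrite (breee (E' a1 a2 a3) (E' b1 b2 b3)).
have intr_eq0 (n : int) : n = 0 -> n%:~R = 0 :> K by move=> ->.
apply: comb4; rewrite -?mulrDr -!intrD.
- by apply: intr_eq0; ring.
- by apply: intr_eq0; ring.
- by apply: intr_eq0; ring.
by rewrite cocycle_jacobi mulr0.
Qed.

End BracketOfBasis.

(* Finitely supported functions on the basis: [Some (p, q)] stands for
   L_{p,q} and [None] for the central element c. *)
Definition virasoro_like (K : numFieldType) : Type := {malg K[option (int * int)]}.

HB.instance Definition _ (K : numFieldType) :=
  GRing.Lmodule.on (virasoro_like K).

Section VirasoroLike.
Variable K : numFieldType.
Local Notation g := (virasoro_like K).

Definition vL (al : int * int) : g := << Some al >>.
Definition vc : g := << None >>.

Definition basis_bracket (i j : option (int * int)) : g :=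
  match i, j with
  | Some (a1, b1), Some (a2, b2) =>
      (a2 - a1)%:~R *: vL (a1 + a2, b1 + b2 + 1)
      + (b2 - b1)%:~R *: vL (a1 + a2, b1 + b2)
      + (12%:R^-1 * (cocycle (a1, b1) (a2, b2))%:~R) *: vc
  | _, _ => 0
  end.

Definition bracket (x y : g) : g :=
  \sum_(i <- msupp x) \sum_(j <- msupp y) (x@_i * y@_j) *: basis_bracket i j.

Lemma linear_combE (x : g) (d : {fset option (int * int)})
    (F : option (int * int) -> g) :
  (msupp x `<=` d)%fset ->
  \sum_(i <- msupp x) x@_i *: F i = \sum_(i <- d) x@_i *: F i.
Proof.
move=> sub; apply: big_fset_incl => // i _ /mcoeff_outdom ->.
by rewrite scale0r.
Qed.

Let ext (F : option (int * int) -> g) (x : g) :=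
  \sum_(i <- msupp x) x@_i *: F i.

Let extD F : {morph ext F : x y / x + y}.
Proof.
move=> x y; rewrite /ext (linear_combE F (msuppD_le x y)).
rewrite (linear_combE F (fsubsetUl (msupp x) (msupp y))).
rewrite (linear_combE F (fsubsetUr (msupp x) (msupp y))) -big_split /=.
by apply: eq_bigr => i _; rewrite mcoeffD scalerDl.
Qed.

Let extZ F a x : ext F (a *: x) = a *: ext F x.
Proof.
rewrite /ext (linear_combE F (msuppZ_le a x)) scaler_sumr.
by apply: eq_bigr => i _; rewrite mcoeffZ scalerA.
Qed.

Let extU F k : ext F << k >> = F k.
Proof. by rewrite /ext msuppU oner_eq0 big_seq_fset1 mcoeffUU scale1r. Qed.

Let bracketEl x y :
  bracket x y = ext (fun i => ext (basis_bracket i) y) x.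
Proof.
apply: eq_bigr => i _; rewrite /ext scaler_sumr; apply: eq_bigr => j _.
by rewrite scalerA.
Qed.

Let bracketEr x y :
  bracket x y = ext (fun j => ext (basis_bracket^~ j) x) y.
Proof.
rewrite /bracket exchange_big; apply: eq_bigr => j _.
rewrite /ext scaler_sumr; apply: eq_bigr => i _.
by rewrite scalerA mulrC.
Qed.

Lemma bracketDl y : {morph bracket^~ y : x1 x2 / x1 + x2}.
Proof. by move=> x1 x2; rewrite !bracketEl extD. Qed.

Lemma bracketZl (a : K) x y : bracket (a *: x) y = a *: bracket x y.
Proof. by rewrite !bracketEl extZ. Qed.

Lemma bracketDr x : {morph bracket x : y1 y2 / y1 + y2}.
Proof. by move=> y1 y2; rewrite !bracketEr extD. Qed.

Lemma bracketZr (a : K) x y : bracket x (a *: y) = a *: bracket x y.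
Proof. by rewrite !bracketEr extZ. Qed.

Lemma bracketUU i j : bracket << i >> << j >> = basis_bracket i j.
Proof. by rewrite bracketEl !extU. Qed.

Lemma bracket0l y : bracket 0 y = 0.
Proof. by have := bracketZl 0 0 y; rewrite !scale0r. Qed.

Lemma bracket0r x : bracket x 0 = 0.
Proof. by have := bracketZr 0 x 0; rewrite !scale0r. Qed.

Lemma virasoro_like_ind (P : g -> Prop) :
  P 0 -> (forall x y, P x -> P y -> P (x + y)) ->
  (forall (a : K) x, P x -> P (a *: x)) -> (forall i, P << i >>) ->
  forall x, P x.
Proof.
move=> P0 PD PZ PU x; rewrite (monalgE x); elim/big_ind: _ => // i _.
have -> : << x@_i *g i >> = x@_i *: (<< i >> : g); last exact: PZ.
by apply/malgP => k; rewrite mcoeffZ !mcoeffU mulrnAr mulr1.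
Qed.

Let brNe i : bracket << None >> << i >> = 0.
Proof. exact: bracketUU. Qed.

Let breN i : bracket << i >> << None >> = 0.
Proof. by rewrite bracketUU; case: i => [[]|]. Qed.

Lemma bracket_vL a1 b1 a2 b2 :
  bracket (vL (a1, b1)) (vL (a2, b2)) =
    (a2 - a1)%:~R *: vL (a1 + a2, b1 + b2 + 1)
    + (b2 - b1)%:~R *: vL (a1 + a2, b1 + b2)
    + (12%:R^-1 * (cocycle (a1, b1) (a2, b2))%:~R) *: vc.
Proof. exact: bracketUU. Qed.

Lemma bracketxx x : bracket x x = 0.
Proof.
exact: (brxx virasoro_like_ind bracketDl bracketZl bracketDr bracketZr
  brNe breN bracket_vL).
Qed.

Lemma bracket_jacobi x y z :
  bracket x (bracket y z) + bracket y (bracket z x)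
  + bracket z (bracket x y) = 0.
Proof.
exact: (br_jacobi virasoro_like_ind bracketDl bracketZl bracketDr bracketZr
  brNe breN bracket_vL).
Qed.

HB.instance Definition _ := Lmodule_isLieAlgebra.Build K (virasoro_like K)
  bracketDl bracketZl bracketDr bracketZr bracketxx bracket_jacobi.

End VirasoroLike.

Definition is_Zbasis (al1 al2 : int * int) : Prop :=
  forall al, exists k1 k2 : int, al = al1 *~ k1 + al2 *~ k2.

Definition e2 : int * int := (0, 1).

Definition is_GHW (K : numFieldType) (V : lieModType (virasoro_like K)) : Prop :=
  exists v : V, generates v /\
  exists al1 al2 : int * int, is_Zbasis al1 al2 /\
  forall k1 k2 k : nat, ~ (k1 = 0%N /\ k2 = 0%N) -> (k <= k1 + k2)%N ->
    act (vL K (al1 *+ k1 + al2 *+ k2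
               + e2 *+ (k * (1 - (k1 * k2 == 0)))%N)) v = 0.

(* Main.v *)
Require Import Defs.
From mathcomp Require Import all_boot all_order all_algebra.
From mathcomp Require Import complex reals.
From mathcomp Require Import boolp ring zify.
Import GRing.Theory.
Local Open Scope ring_scope.
Local Open Scope complex_scope.

(** If no nonzero vector of [W r s] is killed by a given finite family of
operators, then [dim W r s] is at most the sum of the dimensions of the targets.
A vector killed by a block of [L_{a+i, b+j}], [0 <= i <= m], [0 <= j <= 4], is
killed by a cone of [L]'s, which contains the set required by the definition of
a GHW vector as soon as the block contains a suitable Z-basis.
So assume that V is not GHW.  The operators [L_{1, -s+j}] send [W r s] to a
part of column r + 1 that does not depend on s, hence every column is bounded.
The operators [L_{-r, j}] and [L_{-r+1, j}] send [W r s] to the columns 0 and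
1, hence the bound is uniform in r as well. *)

(** * Spanning families and a dimension bound from injectivity *)

Section Spanning.
Context {K : fieldType} {V : lmodType K}.
Implicit Types U : V -> Prop.

Definition spanned_by (N : nat) U : Prop :=
  exists w : 'I_N -> V, forall u, U u -> exists c, u = \sum_i c i *: w i.

Lemma has_dim_spanned d U : has_dim U d -> spanned_by d U.
Proof. by case=> e [_ _ He]; exists e. Qed.

Lemma spanned_by_add N1 N2 U1 U2 :
  spanned_by N1 U1 -> spanned_by N2 U2 ->
  spanned_by (N1 + N2) (fun u => exists u1 u2, [/\ U1 u1, U2 u2 & u = u1 + u2]).
Proof.
case=> [w1 H1] [w2 H2].
exists (fun i => match split i with inl i1 => w1 i1 | inr i2 => w2 i2 end).
move=> u [u1 [u2 [/H1[c1 ->] /H2[c2 ->] ->]]].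
exists (fun i => match split i with inl i1 => c1 i1 | inr i2 => c2 i2 end).
rewrite big_split_ord; congr (_ + _); apply: eq_bigr => i _ /=.
  by rewrite (unsplitK (inl i)).
by rewrite (unsplitK (inr i)).
Qed.

Lemma spanned_by_weaken N1 N2 U :
  (N1 <= N2)%N -> spanned_by N1 U -> spanned_by N2 U.
Proof.
move=> /subnKC <- [w H]; have sp0 : spanned_by (N2 - N1) (fun u : V => u = 0).
  by exists (fun=> 0) => u ->; exists (fun=> 0); rewrite big1 // => i _; rewrite scaler0.
have [w' H'] := spanned_by_add _ _ _ _ (ex_intro _ w H) sp0.
by exists w' => u Uu; apply: H'; exists u, 0; rewrite addr0.
Qed.

Lemma spanned_by_max (n : nat) (U : nat -> V -> Prop) :
  (forall i, exists N, spanned_by N (U i)) ->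
  exists N, forall i, (i < n)%N -> spanned_by N (U i).
Proof.
move=> fin; elim: n => [|n [N IH]]; first by exists 0%N.
have [N' HN'] := fin n; exists (maxn N N') => i.
rewrite ltnS leq_eqVlt => /orP[/eqP->|/IH].
  by apply: spanned_by_weaken HN'; rewrite leq_maxr.
by apply: spanned_by_weaken; rewrite leq_maxl.
Qed.

(** The maps [f j] together embed [U] into a sum of #|J| spaces, each spanned by [N] vectors. The
    spanning families need not be free, so coordinates of each [f j (e i)] are chosen once and for
    all. If [d] exceeded #|J| * N, the matrix of these coordinates would have a nonzero left kernel
    vector, that is, a nontrivial combination of the [e i] killed by all [f j]. *)
Lemma dim_le_of_ker0 (J : finType) (f : J -> V -> V) (N d : nat) U :
  (forall j, {morph f j : u v / u + v}) ->
  (forall j a, {morph f j : u / a *: u}) ->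
  is_subspace U -> has_dim U d ->
  (forall j, exists2 T, spanned_by N T & forall u, U u -> T (f j u)) ->
  (forall u, U u -> (forall j, f j u = 0) -> u = 0) ->
  (d <= #|J| * N)%N.
Proof.
move=> fD fZ [U0 Ulin] [e [Ue efree _]] HT ker0.
have f0 j : f j 0 = 0 by have := fZ j 0 0; rewrite !scale0r.
have fsum j (c : 'I_d -> K) : f j (\sum_i c i *: e i) = \sum_i c i *: f j (e i).
  by rewrite (big_morph (f j) (fD j) (f0 j)); apply: eq_bigr => i _; rewrite fZ.
have /choice[w Hw] j : exists w : 'I_N -> V, forall i : 'I_d,
    exists c, f j (e i) = \sum_k c k *: w k.
  by have [T [w Hw] TU] := HT j; exists w => i; apply/Hw/TU/Ue.
have /choice[C HC] (ji : J * 'I_d) :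
    exists c, f ji.1 (e ji.2) = \sum_k c k *: w ji.1 k by apply: Hw.
rewrite leqNgt; apply/negP => ltd.
pose M : 'M[K]_(d, #|{: J * 'I_N}|) :=
  \matrix_(i, q) C ((enum_val q).1, i) (enum_val q).2.
have kerM : kermx M != 0.
  rewrite -mxrank_eq0 mxrank_ker subn_eq0 -ltnNge.
  by apply: leq_ltn_trans (rank_leq_col M) _; rewrite card_prod card_ord.
have [c /sub_kermxP cM /negP c0] := rowV0Pn kerM.
case: c0; apply/eqP/rowP => i; rewrite [RHS]mxE.
apply: (efree (c 0)); apply: ker0.
  by elim/big_rec: _ => // k x _ Ux; apply: Ulin.
move=> j; rewrite fsum.
under eq_bigr => k _ do rewrite (HC (j, k)) scaler_sumr.
rewrite exchange_big big1 //= => k _.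
have /rowP/(_ (enum_rank (j, k))) := cM; rewrite !mxE => cM0.
rewrite -[RHS](scale0r (w j k)) -cM0 scaler_suml; apply: eq_bigr => l _.
by rewrite !mxE enum_rankK scalerA.
Qed.

End Spanning.

(* Over an abstract Lie algebra, so that unification never unfolds
   [virasoro_like]. *)
Lemma act_lie_lincomb {K : fieldType} {g : lieAlgType K} {V : lieModType g}
    {x y u w : g} {a b : K} {v : V} :
  lie x y = a *: u + b *: w -> act x v = 0 -> act y v = 0 ->
  a *: act u v + b *: act w v = 0.
Proof.
have act0 (z : g) : act z (0 : V) = 0 by have := actZr 0 z (0 : V); rewrite !scale0r.
by move=> lxy xv yv; rewrite -!actZl -actDl -lxy act_lie xv yv !act0 subr0.
Qed.

Lemma lie_vL (K : numFieldType) (a1 b1 a2 b2 : int) :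
  cocycle (a1, b1) (a2, b2) = 0 ->
  lie (vL K (a1, b1)) (vL K (a2, b2)) =
    (a2 - a1)%:~R *: vL K (a1 + a2, b1 + b2 + 1)
    + (b2 - b1)%:~R *: vL K (a1 + a2, b1 + b2).
Proof.
have add0 (E : lmodType K) (x y z : E) (c : K) :
    x = y + c *: z -> c = 0 -> x = y by move=> -> ->; rewrite scale0r addr0.
move=> c0; apply: add0 (bracket_vL K a1 b1 a2 b2) _.
by rewrite c0 mulr0.
Qed.

(** * Cones of operators that kill a vector *)

Section Killing.
Context {K : numFieldType} {V : lieModType (virasoro_like K)} (v : V).

Definition killed (a b : int) : Prop := act (vL K (a, b)) v = 0.

(* The brackets [L_{a1,b1}, L_{a2,b2}] and [L_{a1,b1+1}, L_{a2,b2-1}] have the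
   same term in [L_{a1+a2,b1+b2+1}], which cancels in their difference. *)
Lemma killed_add (a1 b1 a2 b2 : int) :
  cocycle (a1, b1) (a2, b2) = 0 -> cocycle (a1, b1 + 1) (a2, b2 - 1) = 0 ->
  killed a1 b1 -> killed a1 (b1 + 1) -> killed a2 b2 -> killed a2 (b2 - 1) ->
  killed (a1 + a2) (b1 + b2).
Proof.
have brk p q r s : cocycle (p, q) (r, s) = 0 -> killed p q -> killed r s ->
    (r - p)%:~R *: act (vL K (p + r, q + s + 1)) v
      + (s - q)%:~R *: act (vL K (p + r, q + s)) v = 0.
  by move=> /(lie_vL K)/act_lie_lincomb; apply.
move=> c1 c2 k1 k1' k2 k2'; rewrite /killed.
have E1 := brk _ _ _ _ c1 k1 k2; have E2 := brk _ _ _ _ c2 k1' k2'.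
have e12 : b1 + 1 + (b2 - 1) = b1 + b2 by ring.
move: E2; rewrite e12 -[RHS]E1 => /addrI/eqP.
rewrite -subr_eq0 -scalerBl -intrB scaler_eq0 intr_eq0.
(* What remains is this scalar times the action of the remaining term, and 2 is invertible in
   characteristic 0. *)
have -> : b2 - 1 - (b1 + 1) - (b2 - b1) = -2 by ring.
move=> /eqP; exact.
Qed.

(** Induction on [k]: a point of the block is added to a point of the previous layer by
    [killed_add]. Each layer raises the lower end of the range of [j] by 1 and the upper end by 3.
    The hypothesis on signs makes all cocycles that occur vanish. *)
Lemma killed_cone (m : nat) (a b : int) :
  0 < a \/ 0 <= b ->
  (forall i j : nat, (i <= m)%N -> (j <= 4)%N -> killed (a + i%:Z) (b + j%:Z)) ->
  forall k i j : nat, (i <= k.+1 * m)%N -> (k <= j <= 3 * k + 4)%N ->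
    killed (a * k.+1%:Z + i%:Z) (b * k.+1%:Z + j%:Z).
Proof.
move=> sgn base; elim=> [|k IH] i j Hi Hj.
  by rewrite !mulr1; apply: base; lia.
have [i1 [i2 [le_i1 le_i2 def_i]]] :
    exists i1 i2, [/\ (i1 <= m)%N, (i2 <= k.+1 * m)%N & i = (i1 + i2)%N].
  by exists (minn i m), (i - minn i m)%N; split; nia.
(* [killed_add] uses heights [j1], [j1 + 1] in the block and [j2], [j2 + 1] in the previous layer,
   so [j1] stops at 3 and [j2] at [3 * k + 3]. *)
have [j1 [j2 [le_j1 le_j2 def_j]]] :
    exists j1 j2, [/\ (j1 <= 3)%N, (k <= j2 <= 3 * k + 3)%N & j = (j1 + j2).+1].
  by exists (minn 3 (j - k.+1)), (j - (minn 3 (j - k.+1)).+1)%N; split; lia.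
have coc (p q : int) : b <= p -> b * k.+1%:Z <= q ->
    cocycle (a + i1%:Z, p) (a * k.+1%:Z + i2%:Z, q) = 0.
  move=> le_p le_q; rewrite /cocycle; case: sgn => [a0|b0].
    by rewrite (_ : _ == 0 = false) ?mul0r //; nia.
  (* With both heights nonnegative, only the term for p + q = 0 can survive; then p = 0, and its
     factor p kills it. *)
  have [p0 q0] : 0 <= p /\ 0 <= q by split; nia.
  do 3 (rewrite (_ : p + q == _ = false) ?mulr0 ?mul0r; last by lia).
  rewrite !add0r; have [pq0|_] := eqVneq (p + q) 0; last by rewrite !mul0r mulr0.
  by rewrite (_ : p = 0) ?(mul0r, mulr0) //; lia.
have -> : a * k.+2%:Z + i%:Z = (a + i1%:Z) + (a * k.+1%:Z + i2%:Z) by lia.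
have -> : b * k.+2%:Z + j%:Z = (b + j1%:Z) + (b * k.+1%:Z + j2.+1%:Z) by lia.
have ej1 : b + j1%:Z + 1 = b + j1.+1%:Z by lia.
have ej2 : b * k.+1%:Z + j2.+1%:Z - 1 = b * k.+1%:Z + j2%:Z by lia.
apply: killed_add; rewrite ?ej1 ?ej2.
- by apply: coc; lia.
- by apply: coc; lia.
- by apply: base; lia.
- by apply: base; lia.
- by apply: IH; lia.
- by apply: IH; lia.
Qed.

Lemma pair_mulrn (x y : int) n : (x, y) *+ n = (x * n%:Z, y * n%:Z).
Proof.
elim: n => [|n IH]; first by rewrite !mulr0.
by rewrite mulrS IH; congr pair; rewrite /=; lia.
Qed.

Lemma pair_mulrz (x y k : int) : (x, y) *~ k = (x * k, y * k).
Proof.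
case: k => n; first exact: pair_mulrn.
by rewrite NegzE mulrNz -pmulrn pair_mulrn !mulrN.
Qed.

Hypothesis irrV : irreducible_module V.
Hypothesis v0 : v <> 0.

Lemma irreducible_generates : generates v.
Proof. by move=> U /(irrV.2 U)[U0 /U0|]. Qed.

Lemma GHW_of_killed (x1 y1 x2 y2 : int) :
  (forall p q, exists k1 k2 : int, p = x1 * k1 + x2 * k2 /\ q = y1 * k1 + y2 * k2) ->
  (forall k1 k2 k : nat, (0 < k1 + k2)%N -> (k <= k1 + k2)%N ->
     killed (x1 * k1%:Z + x2 * k2%:Z) (y1 * k1%:Z + y2 * k2%:Z + k%:Z)) ->
  is_GHW V.
Proof.
move=> bas kil; exists v; split; first exact: irreducible_generates.
exists (x1, y1), (x2, y2); split=> [[p q]|k1 k2 k nz le_k].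
  have [k1 [k2 [-> ->]]] := bas p q; exists k1, k2.
  by rewrite !pair_mulrz.
(* The multiple of [e2] is [k] or 0, so it stays in the range where [kil] applies. *)
set n := (k * _)%N; have le_n : (n <= k1 + k2)%N by rewrite /n; nia.
have gt0 : (0 < k1 + k2)%N by lia.
have -> : (x1, y1) *+ k1 + (x2, y2) *+ k2 + e2 *+ n
    = (x1 * k1%:Z + x2 * k2%:Z, y1 * k1%:Z + y2 * k2%:Z + n%:Z).
  by rewrite !pair_mulrn; congr pair; rewrite /=; lia.
exact: kil gt0 le_n.
Qed.

(** The basis (1, b+1), (1, b+2) has determinant 1. With n = k1 + k2, the cone contains the offsets
    from n - 1 to 3n + 1 above b * n in column n, and those required, k1 + 2 * k2 + k, lie between n
    and 3n. *)
Lemma GHW_of_killed_column (b : int) :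
  (forall j : nat, (j <= 4)%N -> killed 1 (b + j%:Z)) -> is_GHW V.
Proof.
move=> base; apply: (GHW_of_killed 1 (b + 1) 1 (b + 2)) => [p q|k1 k2 k K0 leK].
  by exists (p - (q - p * (b + 1))), (q - p * (b + 1)); split; ring.
have base0 (i j : nat) : (i <= 0)%N -> (j <= 4)%N -> killed (1 + i%:Z) (b + j%:Z).
  by rewrite leqn0 => /eqP->; rewrite addr0; apply: base.
have := killed_cone 0 1 b (or_introl isT) base0.
have def_n : (k1 + k2)%N = (k1 + k2).-1.+1 by lia.
move/(_ (k1 + k2).-1 0%N (k1 + 2 * k2 + k)%N).
have -> : 1 * (k1 + k2).-1.+1%:Z + 0%:Z = 1 * k1%:Z + 1 * k2%:Z :> int by lia.
have -> : b * (k1 + k2).-1.+1%:Z + (k1 + 2 * k2 + k)%:Z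
  = (b + 1) * k1%:Z + (b + 2) * k2%:Z + k%:Z by rewrite -def_n; lia.
by apply; lia.
Qed.

(** The basis (a, 1), (a+1, 1) has determinant -1. With n = k1 + k2, the required heights n + k lie
    between n and 2n, inside the cone over the block at height 0; [a] may have any sign. *)
Lemma GHW_of_killed_rows (a : int) :
  (forall i j : nat, (i <= 1)%N -> (j <= 4)%N -> killed (a + i%:Z) j%:Z) -> is_GHW V.
Proof.
move=> base; apply: (GHW_of_killed a 1 (a + 1) 1) => [p q|k1 k2 k K0 leK].
  by exists (q - (p - a * q)), (p - a * q); split; ring.
have base0 (i j : nat) : (i <= 1)%N -> (j <= 4)%N -> killed (a + i%:Z) (0 + j%:Z).
  by rewrite add0r; apply: base.
have := killed_cone 1 a 0 (or_intror isT) base0.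
have def_n : (k1 + k2)%N = (k1 + k2).-1.+1 by lia.
move/(_ (k1 + k2).-1 k2 (k1 + k2 + k)%N).
have -> : a * (k1 + k2).-1.+1%:Z + k2%:Z = a * k1%:Z + (a + 1) * k2%:Z.
  by rewrite -def_n; lia.
have -> : 0 * (k1 + k2).-1.+1%:Z + (k1 + k2 + k)%:Z
  = 1 * k1%:Z + 1 * k2%:Z + k%:Z :> int by lia.
by apply; lia.
Qed.

End Killing.

(** * Dimension bounds for a module that is not GHW *)

Section Bounds.
Context {K : numFieldType} {V : lieModType (virasoro_like K)}.
Variable W : int -> int -> V -> Prop.
Hypothesis irrV : irreducible_module V.
Hypothesis Wsub : forall r s, is_subspace (W r s).
Hypothesis Wfin : forall r s, finite_dim (W r s).
Hypothesis Wact : forall (a b r s : int) (v : V), W r s v ->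
  exists x y z : V,
    [/\ W (r + a) (s + b + 2) x, W (r + a) (s + b + 1) y, W (r + a) (s + b) z
      & act (vL K (a, b)) v = x + y + z].
Hypothesis notGHW : ~ is_GHW V.

Lemma act_spanned (N : nat) (a b r s : int) :
  (forall j : nat, (j <= 2)%N -> spanned_by N (W (r + a) (s + b + j%:Z))) ->
  exists2 T, spanned_by (N + N + N) T
    & forall v, W r s v -> T (act (vL K (a, b)) v).
Proof.
move=> sp; have sp0 := sp 0%N isT; rewrite addr0 in sp0.
have sp21 := spanned_by_add _ _ _ _ (sp 2 isT) (sp 1%N isT).
eexists => [|v Wv]; first exact: spanned_by_add sp21 sp0.
have [x [y [z [Wx Wy Wz ->]]]] := Wact a b r s v Wv.
by exists (x + y), z; split=> //; exists x, y.
Qed.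

Lemma dim_le_of_killed (J : finType) (al : J -> int * int) (N d : nat) (r s : int) :
  has_dim (W r s) d ->
  (forall q (j : nat), (j <= 2)%N ->
     spanned_by N (W (r + (al q).1) (s + (al q).2 + j%:Z))) ->
  (forall v : V, v <> 0 -> (forall q, killed v (al q).1 (al q).2) -> is_GHW V) ->
  (d <= #|J| * (N + N + N))%N.
Proof.
move=> dimd sp GHW.
apply: (dim_le_of_ker0 J (fun q => act (vL K (al q))) _ _ (W r s)) => //.
- by move=> q u v; apply: actDr.
- by move=> q a u; apply: actZr.
- by move=> q; have := act_spanned N _ _ _ _ (sp q); rewrite -surjective_pairing.
move=> v _ kil; apply: contrapT => v0; apply/notGHW/(GHW v v0) => q.
by rewrite /killed -surjective_pairing.
Qed.

Lemma column_bounded (r : int) : exists N, forall s, spanned_by N (W r s).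
Proof.
(* The operators [L_{1, -s+q}] with q <= 4 send row s to rows q, q + 1 and q + 2, hence to rows 0 to
   6. *)
have [|N HN] := spanned_by_max 7 (fun j => W (r + 1) j%:Z).
  by move=> j; have [d /has_dim_spanned] := Wfin (r + 1) j%:Z; exists d.
exists (#|'I_5| * (N + N + N))%N => s; have [d dimd] := Wfin r s.
apply: spanned_by_weaken (has_dim_spanned _ _ dimd).
apply: (dim_le_of_killed 'I_5 (fun j => (1, - s + j%:Z)) _ _ r s dimd) => [q j le_j|v v0 kil].
  have -> : s + (- s + q%:Z) + j%:Z = (q + j)%:Z :> int by lia.
  by apply: HN; have := ltn_ord q; lia.
apply: (GHW_of_killed_column v irrV v0 (- s)) => j le_j.
exact: (kil (Ordinal (le_j : (j < 5)%N))).
Qed.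

Lemma not_GHW_uniformly_bounded : uniformly_bounded W.
Proof.
have [N0 HN0] := column_bounded 0; have [N1 HN1] := column_bounded 1.
pose N := maxn N0 N1.
(* The successor makes the bound positive even when [N] is 0. *)
exists (#|{: 'I_2 * 'I_5}| * (N + N + N)).+1; split=> // r s.
have [d dimd] := Wfin r s; exists d; split=> //; apply: leqW.
apply: (dim_le_of_killed ('I_2 * 'I_5)%type (fun q => (- r + q.1%:Z, q.2%:Z)) _ _ r s dimd)
  => [[i k] j le_j|v v0 kil].
  rewrite /= addrA addrN add0r; have [->|->] : i = 0 \/ i = 1.
  - by case: i => [[|[|]]] //= lt_i; [left|right]; apply/val_inj.
  - by apply: spanned_by_weaken (HN0 _); rewrite leq_maxl.
  by apply: spanned_by_weaken (HN1 _); rewrite leq_maxr.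
apply: (GHW_of_killed_rows v irrV v0 (- r)) => i j le_i le_j.
exact: (kil (Ordinal (le_i : (i < 2)%N), Ordinal (le_j : (j < 5)%N))).
Qed.

End Bounds.

Theorem theorem2p6 (R : realType) (V : lieModType (virasoro_like R[i]))
    (W : int -> int -> V -> Prop)
    (Virr : irreducible_module V)
    (Wsub : forall r s, is_subspace (W r s))
    (Wsum : is_direct_sum (fun i : int * int => W i.1 i.2))
    (Wfin : forall r s, finite_dim (W r s))
    (Wact : forall (a b r s : int) (v : V), W r s v ->
      exists x y z : V,
        [/\ W (r + a) (s + b + 2) x, W (r + a) (s + b + 1) y, W (r + a) (s + b) z
          & act (vL R[i] (a, b)) v = x + y + z]) :
  ~ uniformly_bounded W -> is_GHW V.
Proof.
by move=> unbounded; apply: contrapT => /(not_GHW_uniformly_bounded W Virr Wsub Wfin Wact).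
Qed.
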